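(* Let $\varepsilon \neq 0$ be a real constant and let $c$ be any given real constant. Let $u \in C^2(\mathbb{R}^2)$ be a global solution of $$\Delta u = \varepsilon^{-2}\left(e^{u} - (x^2+y^2)e^{-u}\right) \quad \text{in } \mathbb{R}^2,$$ and suppose that $$u(s) - u(t) \to 0 \quad \text{as } |s|,|t| \to \infty \text{ with } |s| - |t| = c,\quad s,t\in\mathbb{R}^2.$$ Then $u$ is radially symmetric (about the origin) and $\dfrac{\partial u}{\partial r} \geq 0$.
   Context: $(x,y)$ are the coordinates of $\mathbb{R}^2$, $r = \sqrt{x^2+y^2}$, $\Delta = \partial_x^2+\partial_y^2$, and $|\cdot|$ is the Euclidean norm. The asymptotic condition means: for every $\delta > 0$ there is $R > 0$ such that $|u(s) - u(t)| < \delta$ for all $s,t \in \mathbb{R}^2$ with $|s|,|t| \geq R$ and $|s|-|t| = c$. The derivative $\partial u/\partial r$ is the radial derivative, for $r>0$. *)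

(* Defs.v *)
From Stdlib Require Import Reals.
From Coquelicot Require Import Coquelicot.

Open Scope R_scope.

(* A function on R^2 is curried, [u : R -> R -> R], as in Coquelicot's
   two-variable calculus. *)

Definition radius (x y : R) : R := sqrt (x ^ 2 + y ^ 2).

(* [ex_diff_n u n x y]: the partial derivatives of [u] of order at most [n]
   exist and are continuous at [(x, y)], so the quantification over all points
   gives [u] in C^2(R^2). *)
Definition C2_plane (u : R -> R -> R) : Prop :=
  forall x y : R, ex_diff_n u 2 x y.

Definition laplacian (u : R -> R -> R) (x y : R) : R :=
  Derive_n (fun z => u z y) 2 x + Derive_n (fun z => u x z) 2 y.

Definition vanishing_differences (c : R) (u : R -> R -> R) : Prop :=
  forall delta : R, 0 < delta ->
  exists R0 : R, 0 < R0 /\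
  forall s1 s2 t1 t2 : R,
    R0 <= radius s1 s2 -> R0 <= radius t1 t2 ->
    radius s1 s2 - radius t1 t2 = c ->
    Rabs (u s1 s2 - u t1 t2) < delta.

Definition radially_symmetric (u : R -> R -> R) : Prop :=
  exists U : R -> R, forall x y : R, u x y = U (radius x y).

(* Derivative at [(x, y) <> (0, 0)] along the ray from the origin, which is
   parametrized by the distance [rho] to the origin. *)
Definition radial_derivative (u : R -> R -> R) (x y : R) : R :=
  let r := radius x y in
  Derive (fun rho => u (rho * (x / r)) (rho * (y / r))) r.

(* Main.v *)
Require Import Defs.
From Stdlib Require Import Reals.
From Coquelicot Require Import Coquelicot.
From Stdlib Require Import Lra Psatz Classical ClassicalEpsilon.

(** Write [k = / eps ^ 2 > 0] and [r] for the radius.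

    Symmetry is a maximum principle.  The equation is invariant under a
    rotation [A], so [w(z) = u(A z) - u(z)] is a difference of two solutions,
    and the right-hand side is strictly increasing in [u].  Hence at a point
    where [w] has a positive maximum the Laplacian of [w] would be positive,
    contradicting the second derivative test.  The asymptotic condition makes
    [w] tend to 0 at infinity (compare both [u(A z)] and [u(z)] with the value
    at one point of radius [r - c]), so a positive value of [w] would force a
    positive maximum to exist.  Therefore [u(A z) <= u(z)] for every rotation
    ([rotation_le]); applying this to [A] and to its inverse gives
    [radial_profile].

    For the monotonicity, let [U(r) = u(r, 0)] and use the logarithmic variable
    [t = ln r].  The function [G(t) = t - U(exp t) = ln r - U(r)] satisfies
    [G'' = 2 k exp(3t) sinh G] on the whole line, and [G] is negative near
    minus infinity.  If [G] were positive somewhere, then [H = G ^ 2], which is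
    convex since [G sinh G >= 0], would vanish at some point and be positive
    and increasing later on, with [H'' >= C H ^ 2]; such a function explodes in
    finite time ([quadratic_convexity_blow_up]), whereas [u] is globally
    defined.  So [G <= 0] ([sinh_ode_nonpos]), hence [G'' <= 0] and
    [G' = 1 - r U'(r)] is nonincreasing.  It tends to 1 at minus infinity
    because [U'] is bounded near 0.  Thus [1 - r U'(r) <= 1], that is
    [U' >= 0]. *)

Open Scope R_scope.

(** * Maxima of continuous functions on a square *)

(** A property that holds locally with some margin [d], and that survives when
    the margin shrinks, holds on the whole square with a single margin, by
    compactness.  It serves twice below: to bound a function from above and to
    keep it away from a supremum that is not attained. *)
Lemma compact_square_uniform (L : R) (P : R -> R -> R -> Prop) :
  (forall d d' x y, 0 < d' <= d -> P d x y -> P d' x y) ->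
  (forall a b, - L <= a <= L -> - L <= b <= L -> exists d, 0 < d /\
     forall x y, Rabs (x - a) < d -> Rabs (y - b) < d -> P d x y) ->
  exists d, 0 < d /\
    forall x y, - L <= x <= L -> - L <= y <= L -> P d x y.
Proof.
intros Panti Ploc.
assert (radii : forall a b, {d : posreal |
    - L <= a <= L -> - L <= b <= L ->
    forall x y, Rabs (x - a) < d -> Rabs (y - b) < d -> P d x y}).
{ intros a b; apply constructive_indefinite_description.
  destruct (classic (- L <= a <= L /\ - L <= b <= L)) as [[Ha Hb]|out].
  - destruct (Ploc a b Ha Hb) as [d [Hd Pd]].
    exists (mkposreal d Hd); intros _ _; exact Pd.
  - exists (mkposreal 1 Rlt_0_1); tauto. }
destruct (compactness_value_2d (- L) L (- L) L
            (fun a b => proj1_sig (radii a b))) as [d Hd].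
exists d; split; [apply cond_pos|].
intros x y Hx Hy; apply NNPP; intros nP.
apply (Hd x y Hx Hy); intros [a [b [Ha [Hb [Hxa [Hyb Hdab]]]]]].
apply nP, (Panti (proj1_sig (radii a b))).
- split; [apply cond_pos|exact Hdab].
- exact (proj2_sig (radii a b) Ha Hb x y Hxa Hyb).
Qed.

Lemma continuous_square_max (L : R) (f : R -> R -> R) :
  0 <= L -> (forall x y, continuity_2d_pt f x y) ->
  exists a b, - L <= a <= L /\ - L <= b <= L /\
    forall x y, - L <= x <= L -> - L <= y <= L -> f x y <= f a b.
Proof.
intros HL Hf.
(* First an upper bound on [f], which gives it a supremum [M]. *)
destruct (compact_square_uniform L (fun d x y => f x y <= / d)) as [d [Hd Bd]].
- intros d d' x y Hd H; apply Rle_trans with (1 := H).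
  apply Rinv_le_contravar; lra.
- intros a b _ _.
  assert (Hm : 0 < Rabs (f a b) + 1) by (pose proof (Rabs_pos (f a b)); lra).
  destruct (Hf a b (mkposreal 1 Rlt_0_1)) as [e He]; simpl in He.
  exists (Rmin e (/ (Rabs (f a b) + 1))); split.
  { apply Rmin_pos; [apply cond_pos|apply Rinv_0_lt_compat, Hm]. }
  intros x y Hx Hy.
  assert (H := He x y (Rlt_le_trans _ _ _ Hx (Rmin_l _ _))
                 (Rlt_le_trans _ _ _ Hy (Rmin_l _ _))).
  apply Rle_trans with (Rabs (f a b) + 1).
  + apply Rabs_def2 in H; pose proof (Rle_abs (f a b)); lra.
  + rewrite <- (Rinv_inv (Rabs (f a b) + 1)) at 1.
    apply Rinv_le_contravar; [|apply Rmin_r].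
    apply Rmin_pos; [apply cond_pos|apply Rinv_0_lt_compat, Hm].
- set (E := fun z => exists x y, - L <= x <= L /\ - L <= y <= L /\ z = f x y).
  destruct (completeness E) as [M [Mub Mlub]].
  + exists (/ d); intros z [x [y [Hx [Hy ->]]]]; auto.
  + exists (f 0 0), 0, 0; repeat split; lra.
  + apply NNPP; intros nmax.
    assert (below : forall x y, - L <= x <= L -> - L <= y <= L -> f x y < M).
    { intros x y Hx Hy; apply Rnot_le_lt; intros HM; apply nmax.
      exists x, y; split; [exact Hx|split; [exact Hy|]]; intros x' y' Hx' Hy'.
      apply Rle_trans with (2 := HM); apply Mub; exists x', y'; auto. }
    (* If [M] is not attained, [M - f] has a positive lower bound. *)
    destruct (compact_square_uniform L (fun d x y => f x y <= M - d))
      as [d' [Hd' Bd']].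
    * intros; lra.
    * intros a b Ha Hb.
      assert (Hg : 0 < (M - f a b) / 2) by (specialize (below a b Ha Hb); lra).
      destruct (Hf a b (mkposreal _ Hg)) as [e He]; simpl in He.
      exists (Rmin e ((M - f a b) / 2)); split.
      { apply Rmin_pos; [apply cond_pos|exact Hg]. }
      intros x y Hx Hy.
      assert (H := He x y (Rlt_le_trans _ _ _ Hx (Rmin_l _ _))
                     (Rlt_le_trans _ _ _ Hy (Rmin_l _ _))).
      apply Rabs_def2 in H; pose proof (Rmin_r e ((M - f a b) / 2)); lra.
    * assert (M <= M - d'); [|lra].
      apply Mlub; intros z [x [y [Hx [Hy ->]]]]; auto.
Qed.

(** * The Laplacian at a maximum of a difference *)

Lemma second_derivative_at_max (f f1 : R -> R) (l : R) :
  (forall t, is_derive f t (f1 t)) -> is_derive f1 0 l ->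
  (forall t, f t <= f 0) -> l <= 0.
Proof.
intros Hf Hf1 Hmax; apply Rnot_lt_le; intros Hl.
assert (f10 : f1 0 = 0).
{ pose (Hpr := exist _ (f1 0) (proj1 (is_derive_Reals _ _ _) (Hf 0))
              : derivable_pt f 0).
  exact (deriv_maximum f (- 1) 1 0 Hpr ltac:(lra) ltac:(lra)
           (fun x _ _ => Hmax x)). }
apply is_derive_Reals in Hf1.
destruct (Hf1 l Hl) as [d Hd].
assert (pos : forall t, 0 < t < d -> 0 < f1 t).
{ intros t Ht.
  assert (Hq : Rabs ((f1 (0 + t) - f1 0) / t - l) < l).
  { apply Hd; [lra|rewrite Rabs_pos_eq; lra]. }
  rewrite f10, Rplus_0_l, Rminus_0_r in Hq; apply Rabs_def2 in Hq.
  replace (f1 t) with (f1 t / t * t) by (field; lra).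
  apply Rmult_lt_0_compat; lra. }
assert (Hd0 := cond_pos d).
assert (f 0 < f (d / 2)); [|specialize (Hmax (d / 2)); lra].
destruct (MVT_cor2 f f1 0 (d / 2)) as [t [Ht1 Ht2]]; [lra| |].
- intros t _; apply is_derive_Reals, Hf.
- assert (0 < f1 t * (d / 2 - 0)); [|lra].
  apply Rmult_lt_0_compat; [apply pos|]; lra.
Qed.

(** Continuity of the partial derivatives makes [f] differentiable in the
    sense of Frechet, which is what the chain rule requires. *)
Lemma is_derive_along_line (f : R -> R -> R) (p q a b t : R) :
  (forall x y, ex_diff_n f 1 x y) ->
  is_derive (fun s => f (p + s * a) (q + s * b)) t
    (a * Derive (fun z => f z (q + t * b)) (p + t * a)
     + b * Derive (fun z => f (p + t * a) z) (q + t * b)).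
Proof.
intros Hf.
apply is_derive_Reals.
rewrite (Rmult_comm a), (Rmult_comm b).
apply (derivable_pt_lim_comp_2d f (fun s => p + s * a) (fun s => q + s * b)).
- apply filterdiff_differentiable_pt_lim.
  apply (is_derive_filterdiff f _ _ (fun x y => Derive (fun z => f z y) x)).
  + apply filter_forall; intros [x y]; destruct (Hf x y) as [_ [H _]].
    exact (Derive_correct (fun z => f z y) x H).
  + apply Derive_correct, Hf.
  + apply (continuity_2d_pt_filterlim (fun x y => Derive (fun z => f z y) x)).
    destruct (Hf (p + t * a) (q + t * b)) as [_ [_ [_ [H _]]]]; apply H.
- apply is_derive_Reals; auto_derive; [exact I|ring].
- apply is_derive_Reals; auto_derive; [exact I|ring].
Qed.

Definition directional_derivative (a b : R) (f : R -> R -> R) (x y : R) : R :=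
  a * Derive (fun z => f z y) x + b * Derive (fun z => f x z) y.

Lemma is_derive2_along_line (u : R -> R -> R) (p q a b t : R) :
  C2_plane u ->
  is_derive (fun s => directional_derivative a b u (p + s * a) (q + s * b)) t
    (a * directional_derivative a b (fun x y => Derive (fun z => u z y) x) (p + t * a) (q + t * b)
     + b * directional_derivative a b (fun x y => Derive (fun z => u x z) y)
             (p + t * a) (q + t * b)).
Proof.
intros Hu.
apply (is_derive_plus (fun s => a * Derive (fun z => u z (q + s * b)) (p + s * a))
         (fun s => b * Derive (fun z => u (p + s * a) z) (q + s * b))).
- apply is_derive_scal.
  apply (is_derive_along_line (fun x y => Derive (fun z => u z y) x)).
  intros x y; apply Hu.
- apply is_derive_scal.
  apply (is_derive_along_line (fun x y => Derive (fun z => u x z) y)).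
  intros x y; apply Hu.
Qed.

(** At a maximum of [u(A z) - u(z)], with [A] the rotation of cosine [a] and
    sine [b], the second derivatives along the two coordinate axes are
    nonpositive.  Moving [z] along an axis moves [A z] along the corresponding
    rotated axis, and the second derivatives of [u] in two orthonormal
    directions add up to its Laplacian, the mixed terms cancelling. *)
Lemma laplacian_le_at_max (u : R -> R -> R) (a b x y : R) :
  C2_plane u -> a ^ 2 + b ^ 2 = 1 ->
  (forall x' y', u (a * x' - b * y') (b * x' + a * y') - u x' y'
     <= u (a * x - b * y) (b * x + a * y) - u x y) ->
  laplacian u (a * x - b * y) (b * x + a * y) <= laplacian u x y.
Proof.
intros Hu Hab Hmax.
set (p := a * x - b * y) in *; set (q := b * x + a * y) in *.
set (ux := fun x y => Derive (fun z => u z y) x).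
set (uy := fun x y => Derive (fun z => u x z) y).
assert (C1u : forall x y, ex_diff_n u 1 x y).
{ intros x' y'; apply (ex_diff_n_m 2 1); auto. }
(* Second derivative test along matching lines through [(p, q)] and [(x, y)]. *)
assert (key : forall a1 b1 a2 b2,
  (forall t, u (p + t * a1) (q + t * b1) - u (x + t * a2) (y + t * b2)
     <= u p q - u x y) ->
  a1 * directional_derivative a1 b1 ux p q + b1 * directional_derivative a1 b1 uy p q
  - (a2 * directional_derivative a2 b2 ux x y + b2 * directional_derivative a2 b2 uy x y) <= 0).
{ intros a1 b1 a2 b2 H.
  apply (second_derivative_at_max
    (fun t => u (p + t * a1) (q + t * b1) - u (x + t * a2) (y + t * b2))
    (fun t => directional_derivative a1 b1 u (p + t * a1) (q + t * b1)
              - directional_derivative a2 b2 u (x + t * a2) (y + t * b2))).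
  - intros t.
    apply (is_derive_minus (fun t => u (p + t * a1) (q + t * b1))
             (fun t => u (x + t * a2) (y + t * b2)));
      apply is_derive_along_line; auto.
  - assert (H1 := is_derive2_along_line u p q a1 b1 0 Hu).
    assert (H2 := is_derive2_along_line u x y a2 b2 0 Hu).
    rewrite !Rmult_0_l, !Rplus_0_r in H1, H2.
    exact (is_derive_minus _ _ _ _ _ H1 H2).
  - intros t; rewrite !Rmult_0_l, !Rplus_0_r; apply H. }
assert (H1 := key a b 1 0); assert (H2 := key (- b) a 0 1).
assert (E1 : laplacian u x y
  = 1 * directional_derivative 1 0 ux x y + 0 * directional_derivative 1 0 uy x y
    + (0 * directional_derivative 0 1 ux x y + 1 * directional_derivative 0 1 uy x y)).
{ unfold directional_derivative; change (laplacian u x y)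
    with (Derive (fun z => ux z y) x + Derive (fun z => uy x z) y); ring. }
assert (E2 : laplacian u p q
  = a * directional_derivative a b ux p q + b * directional_derivative a b uy p q
    + (- b * directional_derivative (- b) a ux p q + a * directional_derivative (- b) a uy p q)).
{ unfold directional_derivative; change (laplacian u p q)
    with (Derive (fun z => ux z q) p + Derive (fun z => uy p z) q).
  transitivity ((a ^ 2 + b ^ 2)
    * (Derive (fun z => ux z q) p + Derive (fun z => uy p z) q)); [|ring].
  rewrite Hab; ring. }
assert (H1' := H1 ltac:(intros t;
  generalize (Hmax (x + t * 1) (y + t * 0));
  replace (a * (x + t * 1) - b * (y + t * 0)) with (p + t * a)
    by (unfold p; ring);
  replace (b * (x + t * 1) + a * (y + t * 0)) with (q + t * b)
    by (unfold q; ring); auto)).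
assert (H2' := H2 ltac:(intros t;
  generalize (Hmax (x + t * 0) (y + t * 1));
  replace (a * (x + t * 0) - b * (y + t * 1)) with (p + t * - b)
    by (unfold p; ring);
  replace (b * (x + t * 0) + a * (y + t * 1)) with (q + t * a)
    by (unfold q; ring); auto)).
lra.
Qed.

(** * Radial symmetry *)

Lemma radius_rotation (a b x y : R) :
  a ^ 2 + b ^ 2 = 1 -> radius (a * x - b * y) (b * x + a * y) = radius x y.
Proof.
intros Hab; unfold radius; f_equal.
transitivity ((a ^ 2 + b ^ 2) * (x ^ 2 + y ^ 2)); [ring|rewrite Hab; ring].
Qed.

Lemma radius_axis (r : R) : 0 <= r -> radius r 0 = r.
Proof.
intros Hr; unfold radius.
replace (r ^ 2 + 0 ^ 2) with (r ^ 2) by ring; now apply sqrt_pow2.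
Qed.

Lemma radius_sqr (x y : R) : radius x y ^ 2 = x ^ 2 + y ^ 2.
Proof. unfold radius; rewrite pow2_sqrt; [reflexivity|nra]. Qed.

Lemma abs_le_radius_l (x y : R) : Rabs x <= radius x y.
Proof.
unfold radius; rewrite <- sqrt_Rsqr_abs; apply sqrt_le_1_alt.
unfold Rsqr; nra.
Qed.

Lemma abs_le_radius_r (x y : R) : Rabs y <= radius x y.
Proof.
unfold radius; rewrite <- sqrt_Rsqr_abs; apply sqrt_le_1_alt.
unfold Rsqr; nra.
Qed.

(** Both points are compared with one reference point, of radius smaller by
    [c]; adding [Rabs c] to the threshold keeps that point far out for either
    sign of [c]. *)
Lemma vanishing_on_circles (c : R) (u : R -> R -> R) (d : R) :
  vanishing_differences c u -> 0 < d ->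
  exists R0, 0 < R0 /\ forall x y x' y', R0 <= radius x y ->
    radius x y = radius x' y' -> Rabs (u x y - u x' y') < d.
Proof.
intros Hc Hd.
destruct (Hc (d / 2)) as [R0 [HR0 H]]; [lra|].
exists (R0 + Rabs c); split; [pose proof (Rabs_pos c); lra|].
intros x y x' y' Hr E.
assert (Hr' : R0 <= radius x y - c) by (pose proof (Rle_abs c); lra).
assert (Hr2 : R0 <= radius x y) by (pose proof (Rabs_pos c); lra).
assert (A : radius (radius x y - c) 0 = radius x y - c)
  by (apply radius_axis; lra).
assert (H1 : Rabs (u x y - u (radius x y - c) 0) < d / 2).
{ apply H; rewrite ?A; lra. }
assert (H2 : Rabs (u x' y' - u (radius x y - c) 0) < d / 2).
{ apply H; rewrite ?A; lra. }
apply Rabs_def2 in H1; apply Rabs_def2 in H2; apply Rabs_def1; lra.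
Qed.

Lemma continuity_2d_pt_comp (u f g : R -> R -> R) (x y : R) :
  continuity_2d_pt u (f x y) (g x y) ->
  continuity_2d_pt f x y -> continuity_2d_pt g x y ->
  continuity_2d_pt (fun x y => u (f x y) (g x y)) x y.
Proof.
intros Hu Hf Hg e; destruct (Hu e) as [d Hd].
apply locally_2d_impl with (2 := Hf d); apply locally_2d_impl with (2 := Hg d).
apply locally_2d_forall; auto.
Qed.

(** A positive value of [u(A z) - u(z)] at [(x0, y0)] exceeds all values far
    out, so the maximum over a large enough square is a global one.  There
    the Laplacian comparison contradicts the strict monotonicity of the
    nonlinearity [exp u - r ^ 2 exp (- u)] in [u]. *)
Lemma rotation_le (k c : R) (u : R -> R -> R) (a b : R) :
  0 < k -> C2_plane u ->
  (forall x y, laplacian u x y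
     = k * (exp (u x y) - (x ^ 2 + y ^ 2) * exp (- u x y))) ->
  vanishing_differences c u -> a ^ 2 + b ^ 2 = 1 ->
  forall x y, u (a * x - b * y) (b * x + a * y) <= u x y.
Proof.
intros Hk Hu Hsol Hc Hab x0 y0; apply Rnot_lt_le; intros Hpos.
set (w := fun x y => u (a * x - b * y) (b * x + a * y) - u x y).
destruct (vanishing_on_circles c u (w x0 y0) Hc) as [R0 [HR0 Hfar]];
  [unfold w; lra|].
set (L := Rmax R0 (radius x0 y0)).
assert (HL1 : R0 <= L) by apply Rmax_l.
assert (HL2 : radius x0 y0 <= L) by apply Rmax_r.
assert (ball : forall x y, radius x y <= L -> - L <= x <= L /\ - L <= y <= L).
{ intros x y Hr.
  split; apply Rabs_le_between; apply Rle_trans with (2 := Hr);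
    [apply abs_le_radius_l|apply abs_le_radius_r]. }
assert (cu : forall x y, continuity_2d_pt u x y) by (intros; apply Hu).
assert (cw : forall x y, continuity_2d_pt w x y).
{ intros x y; apply continuity_2d_pt_minus; [|apply cu].
  apply (continuity_2d_pt_comp u (fun x y => a * x - b * y)
           (fun x y => b * x + a * y)); [apply cu|apply continuity_2d_pt_minus|
      apply continuity_2d_pt_plus]; apply continuity_2d_pt_mult;
    auto using continuity_2d_pt_const, continuity_2d_pt_id1,
      continuity_2d_pt_id2. }
destruct (continuous_square_max L w) as [p [q [Hp [Hq Hmax]]]];
  [lra|exact cw|].
assert (Hmax0 : w x0 y0 <= w p q) by (apply Hmax; apply (ball x0 y0); lra).
assert (Hglob : forall x y, w x y <= w p q).
{ intros x y; destruct (Rle_lt_dec (radius x y) L) as [Hr|Hr].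
  - apply Hmax; apply (ball x y); lra.
  - apply Rle_trans with (2 := Hmax0).
    assert (H := Hfar (a * x - b * y) (b * x + a * y) x y).
    rewrite radius_rotation in H by exact Hab.
    specialize (H ltac:(lra) eq_refl); apply Rabs_def2 in H; unfold w at 1; lra. }
assert (Hlap := laplacian_le_at_max u a b p q Hu Hab Hglob).
rewrite !Hsol, <- !radius_sqr, radius_rotation in Hlap by exact Hab.
apply Rmult_le_reg_l in Hlap; [|exact Hk].
assert (Hlt : u p q < u (a * p - b * q) (b * p + a * q)).
{ unfold w in *; lra. }
assert (E1 := exp_increasing _ _ Hlt).
assert (E2 := exp_increasing _ _ (Ropp_lt_contravar _ _ Hlt)).
assert (0 <= radius p q ^ 2) by apply pow2_ge_0.
nra.
Qed.

(** The rotation taking [(r, 0)] to [(x, y)] and its inverse give the two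
    inequalities. *)
Lemma radial_profile (k c : R) (u : R -> R -> R) :
  0 < k -> C2_plane u ->
  (forall x y, laplacian u x y
     = k * (exp (u x y) - (x ^ 2 + y ^ 2) * exp (- u x y))) ->
  vanishing_differences c u ->
  forall x y, u x y = u (radius x y) 0.
Proof.
intros Hk Hu Hsol Hc x y.
assert (rot := fun a b => rotation_le k c u a b Hk Hu Hsol Hc).
assert (Hr := sqrt_pos (x ^ 2 + y ^ 2)); fold (radius x y) in Hr.
assert (Hr2 := radius_sqr x y).
set (r := radius x y) in *.
destruct Hr as [Hr|Hr].
- assert (Hab : (x / r) ^ 2 + (y / r) ^ 2 = 1).
  { transitivity ((x ^ 2 + y ^ 2) / r ^ 2); [field; lra|].
    rewrite <- Hr2; field; lra. }
  apply Rle_antisym.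
  + assert (H := rot (x / r) (y / r) Hab r 0).
    replace (x / r * r - y / r * 0) with x in H by (field; lra).
    replace (y / r * r + x / r * 0) with y in H by (field; lra).
    exact H.
  + assert (H := rot (x / r) (- (y / r)) ltac:(rewrite <- Hab; ring) x y).
    replace (x / r * x - - (y / r) * y) with r in H.
    2: { transitivity ((x ^ 2 + y ^ 2) / r); [rewrite <- Hr2|]; field; lra. }
    replace (- (y / r) * x + x / r * y) with 0 in H by (field; lra).
    exact H.
- rewrite <- Hr in Hr2 |- *; f_equal; nra.
Qed.

(** * Finite-time blow-up *)

Lemma increment_ge_of_derive_ge (f f1 : R -> R) (a b m : R) :
  a <= b -> (forall t, a <= t <= b -> is_derive f t (f1 t)) ->
  (forall t, a <= t <= b -> m <= f1 t) -> f a + m * (b - a) <= f b.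
Proof.
intros Hab Hf Hm.
destruct Hab as [Hab| ->]; [|lra].
destruct (MVT_cor2 f f1 a b Hab) as [t [E Ht]].
- intros t Ht; apply is_derive_Reals, Hf, Ht.
- assert (m * (b - a) <= f1 t * (b - a)); [|lra].
  apply Rmult_le_compat_r; [lra|apply Hm; lra].
Qed.

(** From the point [s] on, [H] grows at least linearly.  The energy
    [H' ^ 2 - (2 / 3) C H ^ 3] is nondecreasing, so once [H] is large enough to
    absorb its initial value, [H' >= m H ^ (3/2)] with [m ^ 2 = C / 3].  Then
    [H ^ (- 1/2)] decreases at a rate of at least [m / 2] and would become
    negative. *)
Lemma quadratic_convexity_blow_up (H H1 H2 : R -> R) (C s : R) :
  0 < C ->
  (forall t, is_derive H t (H1 t)) -> (forall t, is_derive H1 t (H2 t)) ->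
  (forall t, s <= t -> C * H t ^ 2 <= H2 t) ->
  0 < H s -> 0 < H1 s -> False.
Proof.
intros HC DH DH1 Hcv Hs H1s.
assert (slope : forall t, s <= t -> H1 s <= H1 t).
{ intros t Ht.
  assert (X := increment_ge_of_derive_ge H1 H2 s t 0 Ht (fun x _ => DH1 x)).
  rewrite Rmult_0_l, Rplus_0_r in X; apply X.
  intros x Hx; apply Rle_trans with (2 := Hcv x (proj1 Hx)).
  assert (0 <= H x ^ 2) by apply pow2_ge_0; nra. }
assert (linear : forall t, s <= t -> H s + H1 s * (t - s) <= H t).
{ intros t Ht; apply (increment_ge_of_derive_ge H H1); auto.
  intros x Hx; apply slope, Hx. }
set (E := fun t => H1 t ^ 2 - 2 / 3 * C * H t ^ 3).
assert (energy : forall t, s <= t -> E s <= E t).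
{ intros t Ht.
  assert (X := increment_ge_of_derive_ge E
    (fun t => 2 * H1 t * (H2 t - C * H t ^ 2)) s t 0 Ht).
  rewrite Rmult_0_l, Rplus_0_r in X; apply X.
  - intros x _; unfold E; evar_last.
    + apply (is_derive_minus (fun t => H1 t ^ 2) (fun t => 2 / 3 * C * H t ^ 3)).
      * apply is_derive_pow, DH1.
      * apply is_derive_scal, is_derive_pow, DH.
    + unfold minus, plus, opp; simpl; field.
  - intros x Hx; assert (Y := slope x (proj1 Hx)).
    assert (Z := Hcv x (proj1 Hx)); nra. }
(* [T] is a time from which on [H >= 1 + 3 K / C], by the linear bound. *)
set (K := Rabs (E s)).
set (T := s + (1 + 3 * K / C) / H1 s).
assert (HK : 0 <= 3 * K / C).
{ apply Rmult_le_pos; [pose proof (Rabs_pos (E s)); fold K in H0; lra|].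
  left; now apply Rinv_0_lt_compat. }
assert (HT : s <= T).
{ unfold T; assert (0 < (1 + 3 * K / C) / H1 s); [|lra].
  apply Rdiv_lt_0_compat; lra. }
assert (large : forall t, T <= t -> 1 + 3 * K / C <= H t).
{ intros t Ht; apply Rle_trans with (2 := linear t ltac:(lra)).
  assert (X : 1 + 3 * K / C = H1 s * (T - s)) by (unfold T; field; lra).
  assert (H1 s * (T - s) <= H1 s * (t - s)); [|lra].
  apply Rmult_le_compat_l; lra. }
set (m := sqrt (C / 3)).
assert (Hm : 0 < m) by (apply sqrt_lt_R0; lra).
assert (m2 : m ^ 2 = C / 3) by (apply pow2_sqrt; lra).
assert (fast : forall t, T <= t -> m * (H t * sqrt (H t)) <= H1 t).
{ intros t Ht.
  assert (X := large t Ht); assert (Y := energy t ltac:(lra)).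
  assert (Hpos : 0 < H t) by lra.
  apply Rsqr_incr_0_var; [|pose proof (slope t ltac:(lra)); lra].
  rewrite !Rsqr_pow2, !Rpow_mult_distr, pow2_sqrt, m2 by lra.
  assert (Z : K <= C / 3 * H t ^ 3).
  { apply Rle_trans with (C / 3 * H t).
    - apply Rmult_le_compat_l with (r := C / 3) in X; [|lra].
      replace (C / 3 * (1 + 3 * K / C)) with (C / 3 + K) in X by (field; lra).
      lra.
    - apply Rmult_le_compat_l; [lra|]; simpl; nra. }
  assert (W : - K <= E s).
  { unfold K; pose proof (Rle_abs (- E s)); rewrite Rabs_Ropp in H0; lra. }
  unfold E in *; simpl in *; lra. }
set (S := fun t => - / sqrt (H t)).
(* At the rate [m / 2], the function [S] climbs from [S T] to 0 by the time [T']. *)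
set (T' := T + (2 / m) * (/ sqrt (H T))).
assert (sqpos : forall t, T <= t -> 0 < sqrt (H t)).
{ intros t Ht; apply sqrt_lt_R0; pose proof (large t Ht); lra. }
assert (HT' : T <= T').
{ unfold T'; assert (0 < 2 / m * / sqrt (H T)); [|lra].
  apply Rmult_lt_0_compat; [apply Rdiv_lt_0_compat; lra|].
  apply Rinv_0_lt_compat, sqpos; lra. }
assert (X := increment_ge_of_derive_ge S
  (fun t => H1 t / (2 * (H t * sqrt (H t)))) T T' (m / 2) HT').
assert (S T' < 0).
{ unfold S; pose proof (Rinv_0_lt_compat _ (sqpos T' HT')); lra. }
assert (m / 2 * (T' - T) = - S T).
{ unfold T', S; field; pose proof (sqpos T); lra. }
assert (S T + m / 2 * (T' - T) <= S T'); [|lra].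
apply X.
- intros t Ht; unfold S; assert (Y := large t (proj1 Ht)).
  assert (Z := sqpos t (proj1 Ht)).
  evar_last.
  + apply (is_derive_opp (fun t => / sqrt (H t))).
    apply is_derive_inv; [|lra].
    apply is_derive_sqrt; [apply DH|lra].
  + unfold opp; simpl.
    rewrite <- (sqrt_sqrt (H t)) at 4 by lra.
    field; lra.
- intros t Ht; assert (Y := large t (proj1 Ht)).
  assert (Z := sqpos t (proj1 Ht)).
  assert (P : 0 < H t * sqrt (H t)) by (apply Rmult_lt_0_compat; lra).
  apply Rmult_le_reg_r with (2 * (H t * sqrt (H t))); [lra|].
  replace (H1 t / (2 * (H t * sqrt (H t))) * (2 * (H t * sqrt (H t))))
    with (H1 t) by (field; lra).
  pose proof (fast t (proj1 Ht)); lra.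
Qed.

(** * The equation in the logarithmic variable *)

Lemma sinh_ge_id (y : R) : 0 <= y -> y <= sinh y.
Proof.
intros Hy.
assert (X := increment_ge_of_derive_ge sinh cosh 0 y 1 Hy).
rewrite sinh_0 in X; enough (0 + 1 * (y - 0) <= sinh y) by lra; apply X.
- intros t _; apply is_derive_Reals, derivable_pt_lim_sinh.
- intros t _; unfold cosh; rewrite exp_Ropp.
  assert (Ht := exp_pos t).
  apply Rmult_le_reg_r with (2 * exp t); [lra|].
  replace ((exp t + / exp t) / 2 * (2 * exp t)) with (exp t ^ 2 + 1)
    by (field; lra).
  pose proof (pow2_ge_0 (exp t - 1)); lra.
Qed.

(** Any power larger than 2 makes [G ^ 2] blow up; the exponent 4 follows from
    [sinh y >= y] alone through the duplication formula
    [sinh x = 2 sinh (x / 2) (1 + 2 sinh (x / 4) ^ 2)]. *)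
Lemma quartic_le_id_mul_sinh (x : R) : x ^ 4 / 8 <= x * sinh x.
Proof.
assert (pos : forall x, 0 <= x -> x ^ 4 / 8 <= x * sinh x).
{ clear x; intros x Hx.
  assert (Y := sinh_ge_id (x / 2) ltac:(lra)).
  assert (Z := sinh_ge_id (x / 2 / 2) ltac:(lra)).
  assert (E : forall y, sinh y = 2 * sinh (y / 2) * (1 + 2 * sinh (y / 2 / 2) ^ 2)).
  { intros y; unfold sinh.
    assert (P := exp_pos (y / 2 / 2)).
    replace (exp y) with (exp (y / 2 / 2) ^ 4).
    2: { simpl; rewrite Rmult_1_r, <- !exp_plus; f_equal; field. }
    replace (exp (- y)) with (/ exp (y / 2 / 2) ^ 4).
    2: { rewrite exp_Ropp; f_equal; simpl; rewrite Rmult_1_r, <- !exp_plus;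
         f_equal; field. }
    replace (exp (y / 2)) with (exp (y / 2 / 2) ^ 2).
    2: { simpl; rewrite Rmult_1_r, <- !exp_plus; f_equal; field. }
    replace (exp (- (y / 2))) with (/ exp (y / 2 / 2) ^ 2).
    2: { rewrite exp_Ropp; f_equal; simpl; rewrite Rmult_1_r, <- !exp_plus;
         f_equal; field. }
    rewrite exp_Ropp; field; lra. }
  rewrite E.
  assert (Q := pow_incr (x / 2 / 2) (sinh (x / 2 / 2)) 2 ltac:(split; lra)).
  replace (x ^ 4 / 8) with (x * (x * (2 * (x / 2 / 2) ^ 2))) by field.
  assert (0 <= (x / 2 / 2) ^ 2) by apply pow2_ge_0.
  apply Rmult_le_compat_l; [exact Hx|apply Rmult_le_compat]; lra. }
destruct (Rle_lt_dec 0 x) as [Hx|Hx]; [auto|].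
replace (x * sinh x) with (- x * sinh (- x)).
- replace (x ^ 4) with ((- x) ^ 4) by ring; apply pos; lra.
- unfold sinh; rewrite Ropp_involutive; field.
Qed.

(** Squaring removes the sign of [G]: [H = G ^ 2] is convex, and a positive
    value of [G] after a zero makes the slope of [H] positive from some point
    [s] on, where [H] meets the hypotheses of the blow-up lemma. *)
Lemma sinh_ode_nonpos (K : R) (G G1 : R -> R) :
  0 < K -> (forall t, is_derive G t (G1 t)) ->
  (forall t, is_derive G1 t (K * exp (3 * t) * sinh (G t))) ->
  (exists t, forall s, s <= t -> G s < 0) -> forall t, G t <= 0.
Proof.
intros HK DG DG1 [t0 Ht0] t1; apply Rnot_lt_le; intros Hpos.
assert (Ht01 : t0 < t1).
{ apply Rnot_le_lt; intros Hle; specialize (Ht0 t1 Hle); lra. }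
set (H := fun t => G t ^ 2).
set (H1 := fun t => 2 * (G t * G1 t)).
set (H2 := fun t => 2 * (G1 t ^ 2 + K * exp (3 * t) * (G t * sinh (G t)))).
assert (DH : forall t, is_derive H t (H1 t)).
{ intros t; unfold H, H1; evar_last; [apply is_derive_pow, DG|simpl; ring]. }
assert (DH1 : forall t, is_derive H1 t (H2 t)).
{ intros t; unfold H1, H2; evar_last.
  - apply is_derive_scal, (is_derive_mult G G1); [apply DG|apply DG1|].
    intros; apply Rmult_comm.
  - unfold plus, mult; simpl; ring. }
assert (H2ge : forall t, K * exp (3 * t) / 4 * H t ^ 2 <= H2 t).
{ intros t; assert (Y := quartic_le_id_mul_sinh (G t)).
  apply Rmult_le_compat_l with (r := K * exp (3 * t)) in Y.
  - unfold H, H2; assert (0 <= G1 t ^ 2) by apply pow2_ge_0; nra.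
  - apply Rmult_le_pos; [lra|left; apply exp_pos]. }
assert (convex : forall s t, s <= t -> H1 s <= H1 t).
{ intros s t Hst.
  assert (X := increment_ge_of_derive_ge H1 H2 s t 0 Hst (fun x _ => DH1 x)).
  rewrite Rmult_0_l, Rplus_0_r in X; apply X; intros x _.
  apply Rle_trans with (2 := H2ge x).
  apply Rmult_le_pos; [|apply pow2_ge_0].
  pose proof (exp_pos (3 * x)); nra. }
destruct (IVT_gen G t0 t1 0) as [z [Hz Gz]].
- intros t; apply derivable_continuous_pt; exists (G1 t); apply is_derive_Reals, DG.
- pose proof (Ht0 t0 (Rle_refl _)); rewrite Rmin_left, Rmax_right; lra.
- rewrite Rmin_left, Rmax_right in Hz by lra.
  assert (Hzt : z < t1).
  { destruct (proj2 Hz) as [|Ez]; [auto|subst z; lra]. }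
  destruct (MVT_cor2 H H1 z t1 Hzt) as [s [Es Hs]].
  { intros t _; apply is_derive_Reals, DH. }
  assert (Hs1 : 0 < H1 s).
  { unfold H in Es at 1 2; rewrite Gz in Es.
    assert (0 < G t1 ^ 2) by (apply pow_lt; lra).
    apply Rmult_lt_reg_r with (t1 - z); lra. }
  apply (quadratic_convexity_blow_up H H1 H2 (K * exp (3 * s) / 4) s); auto.
  + pose proof (exp_pos (3 * s)); nra.
  + intros t Ht; apply Rle_trans with (2 := H2ge t).
    apply Rmult_le_compat_r; [apply pow2_ge_0|].
    assert (exp (3 * s) <= exp (3 * t)); [|nra].
    destruct Ht as [Ht| ->]; [left; apply exp_increasing; lra|lra].
  + unfold H, H1 in *; apply Rnot_le_lt; intros Hle.
    assert (G s = 0) by nra; rewrite H0 in Hs1; lra.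
Qed.

(** For a radial function the first derivative in [y] at [(r, y)] is
    [y * (U'(rho) / rho)] with [rho] the radius of [(r, y)]; the factor [y]
    makes its derivative at [y = 0] equal to [U'(r) / r]. *)
Lemma radial_equation (u : R -> R -> R) (r : R) :
  C2_plane u -> (forall x y, u x y = u (radius x y) 0) -> 0 < r ->
  laplacian u r 0
  = Derive_n (fun z => u z 0) 2 r + Derive (fun z => u z 0) r / r.
Proof.
intros Hu Hrad Hr; unfold laplacian; f_equal.
set (U1 := fun r => Derive (fun z => u z 0) r).
assert (DU : forall r, is_derive (fun z => u z 0) r (U1 r)).
{ intros s; destruct (Hu s 0) as [_ [H _]].
  exact (Derive_correct (fun z => u z 0) s H). }
assert (DU1 : ex_derive U1 r).
{ destruct (Hu r 0) as [_ [_ [_ [[_ [H _]] _]]]]; exact H. }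
assert (Hy : forall y, 0 < r ^ 2 + y ^ 2) by (intros; nra).
assert (Drho : forall y, is_derive (fun z => radius r z) y (y / radius r y)).
{ intros y; unfold radius; evar_last.
  - apply is_derive_sqrt with (df := 2 * y); [|apply Hy].
    auto_derive; [exact I|ring].
  - cbv beta; field; pose proof (sqrt_lt_R0 _ (Hy y)); lra. }
assert (Hrho : radius r 0 = r) by (apply radius_axis; lra).
change (Derive (fun y => Derive (fun z => u r z) y) 0 = U1 r / r).
rewrite (Derive_ext _ (fun y => y * (U1 (radius r y) / radius r y))).
- apply is_derive_unique.
  evar_last.
  + apply (is_derive_mult (fun y => y) (fun y => U1 (radius r y) / radius r y)).
    * apply is_derive_id.
    * apply Derive_correct, ex_derive_div.
      -- apply ex_derive_comp; [rewrite Hrho; exact DU1|].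
         eexists; apply Drho.
      -- eexists; apply Drho.
      -- lra.
    * intros; apply Rmult_comm.
  + rewrite Hrho; unfold plus, mult, one; simpl; ring.
- intros y; apply is_derive_unique.
  apply is_derive_ext with (fun z => u (radius r z) 0).
  { intros z; symmetry; apply Hrad. }
  evar_last.
  + apply (is_derive_comp (fun s => u s 0) (fun z => radius r z)); [apply DU|apply Drho].
  + unfold scal; simpl; unfold mult; simpl.
    field; unfold radius; pose proof (sqrt_lt_R0 _ (Hy y)); lra.
Qed.

(** If [U'(r) < 0] at some [r], then [- s U'(s)] keeps a positive lower bound
    [e] as [s] decreases to 0, because [1 - s U'(s)] is nonincreasing in [s];
    this contradicts the boundedness of [U'] near 0. *)
Lemma radial_slope_nonneg (k : R) (u : R -> R -> R) :
  0 < k -> C2_plane u -> (forall x y, u x y = u (radius x y) 0) ->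
  (forall x y, laplacian u x y
     = k * (exp (u x y) - (x ^ 2 + y ^ 2) * exp (- u x y))) ->
  forall r, 0 < r -> 0 <= Derive (fun z => u z 0) r.
Proof.
intros Hk Hu Hrad Hsol.
set (U := fun z => u z 0).
set (U1 := fun r => Derive U r); set (U2 := fun r => Derive U1 r).
assert (DU : forall r, is_derive U r (U1 r)).
{ intros s; destruct (Hu s 0) as [_ [H _]].
  exact (Derive_correct (fun z => u z 0) s H). }
assert (DU1 : forall r, is_derive U1 r (U2 r)).
{ intros s; destruct (Hu s 0) as [_ [_ [_ [[_ [H _]] _]]]].
  exact (Derive_correct U1 s H). }
assert (ode : forall r, 0 < r ->
  r * U1 r + r ^ 2 * U2 r = k * r ^ 2 * (exp (U r) - r ^ 2 * exp (- U r))).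
{ intros r Hr.
  assert (E := radial_equation u r Hu Hrad Hr); rewrite Hsol in E.
  change (Derive_n (fun z => u z 0) 2 r) with (U2 r) in E.
  change (Derive (fun z => u z 0) r) with (U1 r) in E.
  change (u r 0) with (U r) in E.
  transitivity (r ^ 2 * (U2 r + U1 r / r)); [field; lra|].
  rewrite <- E; ring. }
set (G := fun t => t - U (exp t)).
set (G1 := fun t => 1 - exp t * U1 (exp t)).
assert (DG : forall t, is_derive G t (G1 t)).
{ intros t; unfold G, G1; evar_last.
  - apply (is_derive_minus (fun t => t) (fun t => U (exp t))); [apply is_derive_id|].
    apply (is_derive_comp U exp); [apply DU|apply is_derive_exp].
  - reflexivity. }
assert (DG1 : forall t, is_derive G1 t (2 * k * exp (3 * t) * sinh (G t))).
{ intros t; unfold G1; evar_last.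
  - apply (is_derive_minus (fun _ => 1) (fun t => exp t * U1 (exp t)));
      [apply is_derive_const|].
    apply (is_derive_mult exp (fun t => U1 (exp t)));
      [apply is_derive_exp| |intros; apply Rmult_comm].
    apply (is_derive_comp U1 exp); [apply DU1|apply is_derive_exp].
  - unfold minus, plus, opp, mult, scal, zero; simpl; unfold mult; simpl.
    assert (O := ode (exp t) (exp_pos t)).
    transitivity (- (exp t * U1 (exp t) + exp t ^ 2 * U2 (exp t))); [ring|].
    rewrite O; unfold sinh, G.
    replace (- (t - U (exp t))) with (- t + U (exp t)) by ring.
    replace (exp (3 * t)) with (exp t ^ 3).
    2: { simpl; rewrite Rmult_1_r, <- !exp_plus; f_equal; ring. }
    unfold Rminus; rewrite !exp_plus, (exp_Ropp t).
    field; pose proof (exp_pos t); lra. }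
(* Values near [r = 0] are values of [exp s] for [s] near minus infinity. *)
assert (near0 : forall f : R -> R, continuity_pt f 0 ->
  exists t, forall s, s <= t -> Rabs (f (exp s) - f 0) < 1).
{ intros f Hf; destruct (Hf 1 Rlt_0_1) as [d [Hd Hfd]].
  exists (ln d - 1); intros s Hs; apply Hfd; split.
  - split; [exact I|]; pose proof (exp_pos s); lra.
  - simpl; unfold R_dist; rewrite Rminus_0_r, Rabs_pos_eq by (left; apply exp_pos).
    rewrite <- (exp_ln d Hd); apply exp_increasing; lra. }
assert (cont : forall f f1, (forall t, is_derive f t (f1 t)) -> continuity_pt f 0).
{ intros f f1 D; apply derivable_continuous_pt; exists (f1 0).
  apply is_derive_Reals, D. }
assert (Gneg : forall t, G t <= 0).
{ apply (sinh_ode_nonpos (2 * k) G G1); auto; [lra|].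
  destruct (near0 U (cont U U1 DU)) as [t Ht].
  exists (Rmin t (U 0 - 1)); intros s Hs.
  assert (H1 := Rmin_l t (U 0 - 1)); assert (H2 := Rmin_r t (U 0 - 1)).
  specialize (Ht s ltac:(lra)); apply Rabs_def2 in Ht; unfold G; lra. }
intros r Hr; apply Rnot_lt_le; intros Hneg; fold (U1 r) in Hneg.
set (e := - (r * U1 r)).
assert (He : 0 < e) by (unfold e; nra).
assert (big : forall s, s <= ln r -> e <= - (exp s * U1 (exp s))).
{ intros s Hs.
  assert (X := increment_ge_of_derive_ge (fun t => - G1 t)
    (fun t => - (2 * k * exp (3 * t) * sinh (G t))) s (ln r) 0 Hs).
  assert (- G1 s + 0 * (ln r - s) <= - G1 (ln r)).
  2: { unfold G1 in H; rewrite exp_ln in H by exact Hr; unfold e; lra. }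
  apply X.
  - intros t _; apply (is_derive_opp G1), DG1.
  - intros t _.
    assert (sinh (G t) <= 0).
    { destruct (Gneg t) as [Hg| ->]; [|rewrite sinh_0; lra].
      rewrite <- sinh_0; left; apply sinh_lt, Hg. }
    pose proof (exp_pos (3 * t)); assert (0 < 2 * k * exp (3 * t)) by nra; nra. }
destruct (near0 U1 (cont U1 U2 DU1)) as [t Ht].
set (B := Rabs (U1 0) + 1).
assert (HB : 0 < B) by (unfold B; pose proof (Rabs_pos (U1 0)); lra).
set (s := Rmin (ln r) (Rmin t (ln (e / B) - 1))).
assert (S1 : s <= ln r) by apply Rmin_l.
assert (S2 : s <= Rmin t (ln (e / B) - 1)) by apply Rmin_r.
assert (S3 := Rmin_l t (ln (e / B) - 1)); assert (S4 := Rmin_r t (ln (e / B) - 1)).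
assert (X := big s S1); specialize (Ht s ltac:(lra)).
assert (Es : exp s < e / B).
{ rewrite <- (exp_ln (e / B)) by (apply Rdiv_lt_0_compat; lra).
  apply exp_increasing; lra. }
apply Rmult_lt_compat_r with (r := B) in Es; [|exact HB].
replace (e / B * B) with e in Es by (field; lra).
assert (- U1 (exp s) <= B).
{ apply Rabs_def2 in Ht; unfold B.
  pose proof (Rle_abs (- U1 0)); rewrite Rabs_Ropp in H; lra. }
pose proof (exp_pos s); nra.
Qed.

Theorem theorem1p2 (eps c : R) (u : R -> R -> R)
  (Heps : eps <> 0)
  (Hu : C2_plane u)
  (Hsol : forall x y : R,
     laplacian u x y
     = / eps ^ 2 * (exp (u x y) - (x ^ 2 + y ^ 2) * exp (- u x y)))
  (Hasym : vanishing_differences c u) :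
  radially_symmetric u /\
  (forall x y : R, 0 < radius x y -> 0 <= radial_derivative u x y).
Proof.
assert (Hk : 0 < / eps ^ 2) by (apply Rinv_0_lt_compat, pow2_gt_0, Heps).
assert (Hrad := radial_profile _ c u Hk Hu Hsol Hasym).
split; [exists (fun r => u r 0); exact Hrad|].
intros x y Hr; unfold radial_derivative; set (r := radius x y) in *.
rewrite (Derive_ext_loc _ (fun z => u z 0)).
- apply (radial_slope_nonneg _ u Hk Hu Hrad Hsol r Hr).
- exists (mkposreal r Hr); intros rho Hrho.
  assert (Hpos : 0 < rho).
  { change (Rabs (rho - r) < r) in Hrho; apply Rabs_def2 in Hrho; lra. }
  rewrite Hrad; f_equal; unfold radius.
  replace ((rho * (x / r)) ^ 2 + (rho * (y / r)) ^ 2) with (rho ^ 2).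
  + apply sqrt_pow2; lra.
  + transitivity (rho ^ 2 * (x ^ 2 + y ^ 2) / r ^ 2); [|field; lra].
    rewrite <- radius_sqr; fold r; field; lra.
Qed.
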